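(* Let $F$ be a field of characteristic not two and let $E$ be a finite-dimensional vector space over $F$ with an arbitrary symmetric bilinear form $(U,V)\mapsto U\cdot V$. Suppose the non-null projective triangle $\overline{uvw}$ in $E$ has projective quadrances $q_u=q(v,w)$, $q_v=q(u,w)$, $q_w=q(u,v)$, and projective spreads $S_u=S(uv,uw)$, $S_v=S(vw,vu)$, $S_w=S(wu,wv)$ (all three assumed to be defined). Then $$\left(q_wS_uS_v-S_u-S_v-S_w+2\right)^2=4(1-S_u)(1-S_v)(1-S_w).$$
   Context: A projective point $u=[U]$ is a one-dimensional subspace of $E$, spanned by a non-zero vector $U$; it is null if $U\cdot U=0$, and non-null otherwise. For distinct projective points $u,v$, $uv$ denotes the projective line (two-dimensional subspace) they span. A projective triangle $\overline{uvw}$ is a set of three distinct projective points not contained in a common two-dimensional subspace; it is null if at least one of its projective points is null, and non-null otherwise. The projective quadrance between non-null projective points $u=[U]$, $v=[V]$ is $$q(u,v)=1-\frac{(U\cdot V)^2}{(U\cdot U)(V\cdot V)}.$$ The projective spread between the projective lines $wu$ and $wv$, where $u=[U]$, $v=[V]$, $w=[W]$ with $w$ non-null, is, putting $U'=U-\frac{U\cdot W}{W\cdot W}W$ and $V'=V-\frac{V\cdot W}{W\cdot W}W$, $$S(wu,wv)=1-\frac{(U'\cdot V')^2}{(U'\cdot U')(V'\cdot V')},$$ and it is undefined if one of the denominators is zero. Equivalently, with $a_X=X\cdot X$ and $b_{XY}=X\cdot Y$, $$S(wu,wv)=1-\frac{(a_Wb_{UV}-b_{UW}b_{VW})^2}{(a_Ua_W-b_{UW}^2)(a_Va_W-b_{VW}^2)}.$$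 The bilinear form is not assumed non-degenerate. *)

(* Defs.v *)
From HB Require Import structures.
From mathcomp Require Import all_boot all_order all_algebra ring.

Set Implicit Arguments.
Unset Strict Implicit.
Unset Printing Implicit Defensive.

Import GRing.Theory.
Local Open Scope ring_scope.

Section ProjectiveTrigonometry.

Variables (F : fieldType) (E : vectType F).

Implicit Types (U V W X Y : E) (u v w L M : {vspace E}).

Definition proj_point u : bool := \dim u == 1%N.

Definition proj_line L : bool := \dim L == 2%N.

Definition proj_triangle u v w : Prop :=
  [/\ [&& proj_point u, proj_point v & proj_point w],
      [&& u != v, v != w & u != w]
    & ~ exists L, [&& proj_line L, (u <= L)%VS, (v <= L)%VS & (w <= L)%VS]].

(* {symmetric E} is the type of all symmetric bilinear forms on E, degenerate
   ones included: B is bilinear and B U V = (-1) ^+ false * idfun (B V U). *)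
Variable B : {symmetric E}.

(* A projective point is represented by its non-zero vector vpick u; the lemmas
   at the end show that the notions below depend neither on this choice nor on
   the choice of complement made in proj_spread. *)
Definition null_point u : bool := B (vpick u) (vpick u) == 0.

Definition nonnull_triangle u v w : Prop :=
  proj_triangle u v w /\
  [&& ~~ null_point u, ~~ null_point v & ~~ null_point w].

(* As x / 0 = 0, this is 1 when U or V is null; only non-null vectors matter. *)
Definition vquadrance U V : F := 1 - B U V ^+ 2 / (B U U * B V V).

Definition proj_quadrance u v : F := vquadrance (vpick u) (vpick v).

Definition vproj_perp W U : E := U - (B U W / B W W) *: W.

(* L and M are projective lines through the projective point w.  L :\: w is a
   one-dimensional complement of w in L, i.e. a projective point u != w with
   L = wu, and likewise for M. *)
Definition proj_spread w L M : F :=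
  let W := vpick w in
  vquadrance (vproj_perp W (vpick (L :\: w))) (vproj_perp W (vpick (M :\: w))).

Definition proj_spread_defined w L M : bool :=
  let U' := vproj_perp (vpick w) (vpick (L :\: w)) in
  let V' := vproj_perp (vpick w) (vpick (M :\: w)) in
  [&& ~~ null_point w, B U' U' != 0 & B V' V' != 0].

Lemma vpick_line U : U != 0 -> exists2 c, c != 0 & vpick <[U]> = c *: U.
Proof.
move=> nzU; have /vlineP[c Dc] := memv_pick <[U]>; exists c => //.
apply: contraNneq nzU => c0; move/eqP: Dc.
by rewrite c0 scale0r vpick0 -subv0 -memvE memv0.
Qed.

Lemma null_pointE U : U != 0 -> null_point <[U]> = (B U U == 0).
Proof.
move=> /vpick_line[c nz_c Dc]; rewrite /null_point Dc.
by rewrite linearZl_LR linearZr_LR /= !mulf_eq0 (negPf nz_c).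
Qed.

Lemma vquadranceZ (a b : F) U V : a != 0 -> b != 0 ->
  vquadrance (a *: U) (b *: V) = vquadrance U V.
Proof.
move=> nz_a nz_b; rewrite /vquadrance !linearZl_LR !linearZr_LR /=.
set x := B U V; set y := B U U; set z := B V V; congr (1 - _).
have -> : (a * (b * x)) ^+ 2 = (a * b) ^+ 2 * x ^+ 2 by ring.
have -> : a * (a * y) * (b * (b * z)) = (a * b) ^+ 2 * (y * z) by ring.
by rewrite -mulf_div divff ?mul1r // expf_neq0 // mulf_neq0.
Qed.

Lemma proj_quadranceE U V : U != 0 -> V != 0 ->
  proj_quadrance <[U]> <[V]> = 1 - B U V ^+ 2 / (B U U * B V V).
Proof.
move=> /vpick_line[c nz_c Dc] /vpick_line[d nz_d Dd].
by rewrite /proj_quadrance Dc Dd vquadranceZ.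
Qed.

Lemma vpick_diff_line U W : <[U]>%VS != <[W]>%VS -> U != 0 -> W != 0 ->
  exists c d, c != 0 /\ vpick ((<[W]> + <[U]>) :\: <[W]>) = c *: U + d *: W.
Proof.
move=> neUW nzU nzW; set D := (_ :\: _)%VS; set X := vpick D.
have XD : X \in D by apply: memv_pick.
have /memv_addP[_ /vlineP[d ->] [_ /vlineP[c ->] DX]] :
  X \in (<[W]> + <[U]>)%VS by apply: subvP XD; apply: diffvSl.
exists c, d; split; last by rewrite DX addrC.
apply: contraNneq neUW => c0.
have XW : X \in (D :&: <[W]>)%VS.
  by rewrite memv_cap XD DX c0 scale0r addr0 memvZ ?memv_line.
have := XW; rewrite capv_diff memv0 vpick0 diffv_eq0 subv_add subvv /=.
by move=> sUW; rewrite eqEdim sUW !dim_vline nzU nzW.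
Qed.

Lemma vproj_perpE (c d e : F) U W : c != 0 -> e != 0 -> B W W != 0 ->
  vproj_perp (e *: W) (c *: U + d *: W) = c *: vproj_perp W U.
Proof.
move=> nz_c nz_e nzW; rewrite /vproj_perp linearDl !linearZl_LR !linearZr_LR /=.
rewrite scalerA.
set x := B U W; set y := B W W in nzW *.
have -> : (c * (e * x) + d * (e * y)) / (e * (e * y)) * e = c * (x / y) + d.
  by field; rewrite nzW nz_e.
by rewrite scalerDl scalerBr scalerA opprD addrACA addrN addr0.
Qed.

Lemma proj_spreadE U V W : U != 0 -> V != 0 -> B W W != 0 ->
  <[U]>%VS != <[W]>%VS -> <[V]>%VS != <[W]>%VS ->
  let U' := U - (B U W / B W W) *: W in
  let V' := V - (B V W / B W W) *: W in
  proj_spread <[W]> (<[W]> + <[U]>) (<[W]> + <[V]>)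
    = 1 - B U' V' ^+ 2 / (B U' U' * B V' V').
Proof.
move=> nzU nzV nzBW neU neV /=.
have nzW : W != 0 by apply: contraNneq nzBW => ->; rewrite linear0l.
have [e nz_e De] := vpick_line nzW.
have [a [b [nz_a Da]]] := vpick_diff_line neU nzU nzW.
have [c [d [nz_c Dc]]] := vpick_diff_line neV nzV nzW.
by rewrite /proj_spread De Da Dc !vproj_perpE // vquadranceZ.
Qed.

Lemma proj_spread_definedE U V W : U != 0 -> V != 0 -> B W W != 0 ->
  <[U]>%VS != <[W]>%VS -> <[V]>%VS != <[W]>%VS ->
  let U' := U - (B U W / B W W) *: W in
  let V' := V - (B V W / B W W) *: W in
  proj_spread_defined <[W]> (<[W]> + <[U]>) (<[W]> + <[V]>)
    = (B U' U' != 0) && (B V' V' != 0).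
Proof.
move=> nzU nzV nzBW neU neV /=.
have nzW : W != 0 by apply: contraNneq nzBW => ->; rewrite linear0l.
have [e nz_e De] := vpick_line nzW.
have [a [b [nz_a Da]]] := vpick_diff_line neU nzU nzW.
have [c [d [nz_c Dc]]] := vpick_diff_line neV nzV nzW.
rewrite /proj_spread_defined null_pointE // nzBW De Da Dc !vproj_perpE //=.
by rewrite !linearZl_LR !linearZr_LR /= !mulf_eq0 (negPf nz_a) (negPf nz_c).
Qed.

End ProjectiveTrigonometry.

(* Main.v *)
Require Import Defs.
From HB Require Import structures.
From mathcomp Require Import all_boot all_order all_algebra.
From mathcomp Require Import ring.
Import GRing.Theory.
Local Open Scope ring_scope.

(** The statement is an identity between the minors of the Gram matrix of U, V
    and W, the vectors that span u, v and w.  Write a_X = X.X, let D be the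
    determinant of the matrix, let A_U, A_V, A_W be its principal 2 x 2 minors
    (A_U omits U) and let c_U, c_V, c_W be its off-diagonal cofactors
    (c_U = (U.V)(U.W) - a_U (V.W)).  Then
      q_w = A_W / (a_U a_V)   and   1 - S_u = c_U^2 / (A_V A_W),
    and Jacobi's identity a_U D = A_V A_W - c_U^2 for the adjugate turns the
    latter into S_u = a_U D / (A_V A_W).  Hence
      q_w S_u S_v = D^2 / (A_U A_V A_W),
    where D^2 is the determinant of the adjugate, which is
      A_U A_V A_W + 2 c_U c_V c_W - A_U c_U^2 - A_V c_V^2 - A_W c_W^2.
    Over the denominator A_U A_V A_W, every term of
    q_w S_u S_v - S_u - S_v - S_w + 2 cancels except 2 c_U c_V c_W, so that
    this quantity is 2 c_U c_V c_W / (A_U A_V A_W).  Its square is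
    4 (1 - S_u) (1 - S_v) (1 - S_w).

    The scalar identity is gram_cross_law; spread_gramE and spread_defined_gramE
    translate the spreads and the conditions that they are defined into Gram
    minors. *)

(** x, y, z stand for a_U, a_V, a_W and p, q, r for V.W, U.W, U.V, so that this
    is the cross law with all vectors eliminated.  Only the entries x and y and
    the principal minors are inverted, because q_w, the only quadrance that
    occurs, divides by a_U a_V. *)
Lemma gram_cross_law (F : fieldType) (x y z p q r : F) :
  x != 0 -> y != 0 ->
  y * z - p ^+ 2 != 0 -> x * z - q ^+ 2 != 0 -> x * y - r ^+ 2 != 0 ->
  let Su := 1 - (x * p - r * q) ^+ 2 / ((x * y - r ^+ 2) * (x * z - q ^+ 2)) in
  let Sv := 1 - (y * q - p * r) ^+ 2 / ((y * z - p ^+ 2) * (x * y - r ^+ 2)) in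
  let Sw := 1 - (z * r - q * p) ^+ 2 / ((x * z - q ^+ 2) * (y * z - p ^+ 2)) in
  ((1 - r ^+ 2 / (x * y)) * Su * Sv - Su - Sv - Sw + 2%:R) ^+ 2
    = 4%:R * (1 - Su) * (1 - Sv) * (1 - Sw).
Proof.
move=> nzx nzy nzA nzB nzC Su Sv Sw.
(* The base of the square is twice the product of the off-diagonal cofactors
   over the product of the principal minors. *)
have -> : (1 - r ^+ 2 / (x * y)) * Su * Sv - Su - Sv - Sw + 2%:R =
    2%:R * (r * q - x * p) * (p * r - y * q) * (q * p - z * r) /
    ((y * z - p ^+ 2) * (x * z - q ^+ 2) * (x * y - r ^+ 2)).
  by rewrite /Su /Sv /Sw; field; rewrite nzx nzy nzA nzB nzC.
by rewrite /Su /Sv /Sw; field; rewrite nzA nzB nzC.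
Qed.

Section Gram.

Variables (F : fieldType) (E : vectType F) (B : {symmetric E}).
Implicit Types (U V W : E) (u : {vspace E}).

Lemma sym_formC U V : B U V = B V U.
Proof. by rewrite (hermC B) /= mul1r. Qed.

Lemma proj_pointP u : proj_point u -> exists2 U, U != 0 & u = <[U]>%VS.
Proof.
move=> /eqP dim_u; have nzU : vpick u != 0 by rewrite vpick0 -dimv_eq0 dim_u.
exists (vpick u) => //; apply/esym/eqP.
by rewrite eqEdim -memvE memv_pick dim_vline nzU dim_u.
Qed.

(** Projecting along W is one step of Gaussian elimination: the Gram matrix of
    the projections is the Schur complement of W.W, whose entries are 2 x 2
    minors divided by W.W.  The division disappears from the spreads, in which
    numerator and denominator have the same degree. *)
Lemma perp_gramE U V W : B W W != 0 ->
  B (U - (B U W / B W W) *: W) (V - (B V W / B W W) *: W)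
    = (B W W * B U V - B U W * B V W) / B W W.
Proof.
move=> nzW; rewrite !(linearBl, linearBr) !(linearZl_LR, linearZr_LR) /=.
rewrite (sym_formC W V); set a := B W W in nzW *; field; exact: nzW.
Qed.

Lemma spread_defined_gramE U V W : U != 0 -> V != 0 -> B W W != 0 ->
  <[U]>%VS != <[W]>%VS -> <[V]>%VS != <[W]>%VS ->
  proj_spread_defined B <[W]> (<[W]> + <[U]>) (<[W]> + <[V]>)
    = (B W W * B U U - B U W ^+ 2 != 0) && (B W W * B V V - B V W ^+ 2 != 0).
Proof.
move=> nzU nzV nzW neU neV; rewrite proj_spread_definedE // !perp_gramE //.
by rewrite !mulf_eq0 !invr_eq0 (negPf nzW) !orbF -!expr2.
Qed.

Lemma spread_gramE U V W : U != 0 -> V != 0 -> B W W != 0 ->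
  <[U]>%VS != <[W]>%VS -> <[V]>%VS != <[W]>%VS ->
  proj_spread B <[W]> (<[W]> + <[U]>) (<[W]> + <[V]>)
    = 1 - (B W W * B U V - B U W * B V W) ^+ 2 /
          ((B W W * B U U - B U W ^+ 2) * (B W W * B V V - B V W ^+ 2)).
Proof.
move=> nzU nzV nzW neU neV; rewrite proj_spreadE // !perp_gramE // -!expr2.
rewrite expr_div_n [X in _ / X]mulf_div -expr2 invf_div mulrA.
by rewrite divfK ?expf_neq0.
Qed.

End Gram.

Theorem theorem12 (F : fieldType) (char_not2 : 2%N \notin [pchar F])
    (E : vectType F) (B : {symmetric E}) (u v w : {vspace E})
    (qu qv qw Su Sv Sw : F) :
  nonnull_triangle B u v w ->
  qu = proj_quadrance B v w ->
  qv = proj_quadrance B u w ->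
  qw = proj_quadrance B u v ->
  proj_spread_defined B u (u + v) (u + w) ->
  proj_spread_defined B v (v + w) (v + u) ->
  proj_spread_defined B w (w + u) (w + v) ->
  Su = proj_spread B u (u + v) (u + w) ->
  Sv = proj_spread B v (v + w) (v + u) ->
  Sw = proj_spread B w (w + u) (w + v) ->
  (qw * Su * Sv - Su - Sv - Sw + 2%:R) ^+ 2
    = 4%:R * (1 - Su) * (1 - Sv) * (1 - Sw).
Proof.
move=> [[/and3P[/proj_pointP[U nzU ->] /proj_pointP[V nzV ->]
               /proj_pointP[W nzW ->]] /and3P[neUV neVW neUW] _]].
rewrite !null_pointE // => /and3P[nzUU nzVV nzWW].
have [neVU neWV neWU] : [/\ <[V]>%VS != <[U]>%VS, <[W]>%VS != <[V]>%VS
  & <[W]>%VS != <[U]>%VS] by split; rewrite eq_sym.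
rewrite !spread_defined_gramE // !spread_gramE //.
rewrite (sym_formC _ _ B V U) (sym_formC _ _ B W U) (sym_formC _ _ B W V).
move=> _ _ -> /andP[nzUV nzUW] /andP[nzVW _] _ -> -> ->.
rewrite proj_quadranceE //.
rewrite ![B V V * B U U]mulrC ![B W W * B U U]mulrC ![B W W * B V V]mulrC.
exact: gram_cross_law.
Qed.
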